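(* For any integers $i,j$ with $3\le i\le j$, there exists a finite connected simple graph $G$ with $\operatorname{gon}(G)=i$ and $\operatorname{mfgon}(G)=j$.
   Context: Graphs are finite and connected; in general they may have multiple edges but no loops, and ''simple'' means no multiple edges. A divisor on $G$ is an integer combination $D=\sum_{v\in V(G)}D(v)\,(v)$, with degree $\deg(D)=\sum_v D(v)$; $D$ is effective if $D(v)\ge0$ for all $v$. Two divisors are equivalent if their difference lies in the integer column space of the Laplacian matrix of $G$ (equivalently, they differ by a sequence of chip-firing moves, where firing $v$ sends one chip along each edge incident to $v$). The rank $r(D)$ is $-1$ if $D$ is not equivalent to an effective divisor, and otherwise the largest integer $r\ge0$ such that $D-E$ is equivalent to an effective divisor for every effective $E$ of degree $r$. The (divisorial) gonality $\operatorname{gon}(G)$ is the minimum degree of a divisor of positive rank. An effective divisor $D$ is multiplicity-free if $D(v)\le1$ for all $v$; the multiplicity-free gonality $\operatorname{mfgon}(G)$ is the minimum degree of a multiplicity-free divisor of positive rank. *)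

(* Defs.v *)
From HB Require Import structures.
From mathcomp Require Import all_boot all_order all_algebra.

Set Implicit Arguments.
Unset Strict Implicit.
Unset Printing Implicit Defensive.

Import Order.TTheory GRing.Theory Num.Theory.
Local Open Scope ring_scope.

(* Finite loopless multigraph; [mult u v] is the number of edges joining [u]
   and [v]. *)
Record multigraph := Multigraph {
  vertex :> finType;
  mult : vertex -> vertex -> nat;
  mult_sym : forall u v, mult u v = mult v u;
  mult_irrefl : forall v, mult v v = 0%N
}.

Definition adj (G : multigraph) : rel G := fun u v => (0 < mult u v)%N.

(* The graph without vertices does not count as connected. *)
Definition connected (G : multigraph) : Prop :=
  (0 < #|G|)%N /\ forall u v : G, connect (@adj G) u v.

Definition simple_graph (G : multigraph) : Prop :=
  forall u v : G, (mult u v <= 1)%N.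

Definition divisor (G : multigraph) := {ffun G -> int}.

Section Divisors.
Variable G : multigraph.
Implicit Types D E : divisor G.

Definition deg D : int := \sum_v D v.

Definition effective D : Prop := forall v, 0 <= D v.

Definition valency (v : G) : nat := (\sum_u mult v u)%N.

Definition laplacian (u v : G) : int :=
  if u == v then (valency u)%:Z else - (mult u v)%:Z.

Definition equivalent D E : Prop :=
  exists f : {ffun G -> int},
    D - E = [ffun v => \sum_u laplacian v u * f u].

Definition equiv_effective D : Prop :=
  exists2 E, effective E & equivalent D E.

Definition all_removable D (r : nat) : Prop :=
  forall E, effective E -> deg E = r%:Z -> equiv_effective (D - E).

(* [has_rank D r] is the graph of the rank function r(D). *)
Definition has_rank D (r : int) : Prop :=
  (~ equiv_effective D /\ r = -1) \/
  (equiv_effective D /\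
   exists k : nat, [/\ r = k%:Z, all_removable D k &
     forall m : nat, all_removable D m -> (m <= k)%N]).

Definition positive_rank D : Prop := exists2 r : int, has_rank D r & 0 < r.

Definition multiplicity_free D : Prop :=
  effective D /\ forall v, D v <= 1.

End Divisors.

Definition is_min (P : int -> Prop) (k : int) : Prop :=
  P k /\ forall m, P m -> k <= m.

(* [has_gon G k] means gon(G) = k; [has_mfgon G k] means mfgon(G) = k. *)
Definition has_gon (G : multigraph) : int -> Prop :=
  is_min (fun k => exists2 D : divisor G, positive_rank D & deg D = k).

Definition has_mfgon (G : multigraph) : int -> Prop :=
  is_min (fun k => exists2 D : divisor G,
    multiplicity_free D /\ positive_rank D & deg D = k).

(* Main.v *)
Require Import Defs.
From Stdlib Require Import Classical.
From mathcomp Require Import all_boot all_order all_algebra zify ring.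

Import Order.TTheory GRing.Theory Num.Theory.
Local Open Scope ring_scope.

(* Take a clique of [i - 1] hubs, one of them distinguished, and [j - i + 2]
   branches, each an edge [mid]-[leaf] with [mid] joined to every hub and
   [leaf] joined to the distinguished hub.  Two chips on the distinguished hub
   and one on every other hub form a divisor of positive rank: firing
   everything but a branch moves all chips into that branch.  Conversely, an
   effective divisor of positive rank with no chip at [q] admits a nonempty
   legal firing set avoiding [q].  A cut with at most [i - 1] edges only
   separates leaves from the rest, which bounds the gonality.  If no vertex has
   two chips, a legal firing set contains all hubs but at most one, yet it
   cannot contain a hub if it avoids the [mid] of a branch without chips; so
   every branch needs a chip and the hubs need [i - 2] more.  The complement of
   the independent set made of the leaves and one hub attains this bound. *)

(** * Estimates for finite sums, and maxima of bounded predicates *)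

Lemma Posz_sum (I : Type) (r : seq I) (P : pred I) (F : I -> nat) :
  (\sum_(i <- r | P i) F i)%N%:Z = \sum_(i <- r | P i) (F i)%:Z.
Proof. exact: (big_morph Posz PoszD). Qed.

Lemma sum_ge_count (I : finType) (P : pred I) (F : I -> int) (c : nat) :
  (forall x, 0 <= F x) -> (forall x, P x -> c%:Z <= F x) ->
  ((\sum_(x | P x) 1) * c)%N%:Z <= \sum_x F x.
Proof.
move=> F0 Fc; rewrite big_distrl /= Posz_sum [leRHS](bigID P) /=.
rewrite -[leLHS]addr0 lerD ?sumr_ge0 //; apply: ler_sum => x Px.
by rewrite mul1n Fc.
Qed.

Lemma sum_ge_term (I : finType) (F : I -> int) (x : I) :
  (forall y, 0 <= F y) -> F x <= \sum_y F y.
Proof. by move=> F0; rewrite (bigD1 x) //= lerDl sumr_ge0. Qed.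

(** Provides the largest [k] that the definition of rank asks for. [P] need not be decidable, hence
    the classical case split. *)
Lemma bounded_max (P : nat -> Prop) (N m : nat) :
  P m -> (forall l, P l -> (l <= N)%N) ->
  exists k : nat, [/\ P k, (m <= k)%N & forall l, P l -> (l <= k)%N].
Proof.
elim: N => [|N IH] Pm PN.
  by exists m; split=> // l /PN; lia.
case: (classic (P N.+1)) => [PN1|nP].
  by exists N.+1; split=> //; apply: PN.
apply: IH => // l Pl; have := PN l Pl; rewrite leq_eqVlt => /orP[/eqP lN|//].
by case: nP; rewrite -lN.
Qed.

(** * Chip-firing, equivalence and positive rank *)

Section ChipFiring.
Variable G : multigraph.
Implicit Types (D E : divisor G) (A : {set G}) (f g : {ffun G -> int}).

Definition point (q : G) : divisor G := [ffun v => (v == q)%:Z].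

(** The net loss of chips at each vertex when every [u] fires [f u] times, so [D - firing f] is the
    outcome. In difference form, edges between equal values of [f] drop out. *)
Definition firing f : divisor G :=
  [ffun v => \sum_u (mult v u)%:Z * (f v - f u)].

Lemma laplacian_firing f :
  [ffun v => \sum_u laplacian v u * f u] = firing f.
Proof.
apply/ffunP => v; rewrite !ffunE.
under [RHS]eq_bigr => u _ do rewrite mulrBr.
rewrite sumrB -mulr_suml (bigD1 v) //= /laplacian eqxx.
rewrite [X in _ = _ - X](bigD1 v) //= mult_irrefl mul0r add0r.
congr (_ + _).
  by rewrite /valency Posz_sum.
rewrite -sumrN; apply: eq_bigr => u; rewrite eq_sym => /negbTE ->.
by rewrite mulNr.
Qed.

Lemma equivalentP D E : equivalent D E <-> exists f, D - E = firing f.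
Proof.
by split=> -[f Hf]; exists f; rewrite Hf laplacian_firing.
Qed.

Lemma firingN f : firing (- f) = - firing f.
Proof.
apply/ffunP => v; rewrite !ffunE -sumrN; apply: eq_bigr => u _.
by rewrite !ffunE; ring.
Qed.

Lemma firingD f g : firing (f + g) = firing f + firing g.
Proof.
apply/ffunP => v; rewrite !ffunE -big_split; apply: eq_bigr => u _.
by rewrite !ffunE /=; ring.
Qed.

Lemma equivalent_refl D : equivalent D D.
Proof.
apply/equivalentP; exists 0; rewrite subrr; apply/ffunP => v.
by rewrite !ffunE big1 // => u _; rewrite !ffunE subrr mulr0.
Qed.

Lemma equivalent_sym D E : equivalent D E -> equivalent E D.
Proof.
move=> /equivalentP[f Hf]; apply/equivalentP; exists (- f).
by rewrite firingN -Hf opprB.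
Qed.

Lemma equivalent_trans D E F :
  equivalent D E -> equivalent E F -> equivalent D F.
Proof.
move=> /equivalentP[f Hf] /equivalentP[g Hg]; apply/equivalentP.
by exists (f + g); rewrite firingD -Hf -Hg addrA subrK.
Qed.

Lemma equivalentDr D E F : equivalent D E -> equivalent (D + F) (E + F).
Proof.
move=> /equivalentP[f Hf]; apply/equivalentP.
by exists f; rewrite -Hf opprD addrACA subrr addr0.
Qed.

Lemma degD D E : deg (D + E) = deg D + deg E.
Proof. by rewrite /deg -big_split; apply: eq_bigr => v _; rewrite ffunE. Qed.

Lemma degN D : deg (- D) = - deg D.
Proof. by rewrite /deg -sumrN; apply: eq_bigr => v _; rewrite ffunE. Qed.

Lemma deg_point q : deg (point q) = 1.
Proof.
rewrite /deg (bigD1 q) //= ffunE eqxx big1 // => v /negbTE vq.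
by rewrite ffunE vq.
Qed.

Lemma deg_firing f : deg (firing f) = 0.
Proof.
rewrite /deg; under eq_bigr => v _ do rewrite ffunE.
under eq_bigr => v _ do (under eq_bigr => u _ do rewrite mulrBr; rewrite sumrB).
rewrite sumrB [X in _ - X]exchange_big /=; apply/eqP; rewrite subr_eq0.
by apply/eqP/eq_bigr => v _; apply: eq_bigr => u _; rewrite mult_sym.
Qed.

Lemma deg_equivalent D E : equivalent D E -> deg D = deg E.
Proof.
move=> /equivalentP[f Hf]; apply/eqP.
by rewrite -subr_eq0 -degN -degD Hf deg_firing.
Qed.

Lemma deg_ge0 D : effective D -> 0 <= deg D.
Proof. by move=> D0; apply: sumr_ge0. Qed.

Lemma effectiveD D E : effective D -> effective E -> effective (D + E).
Proof. by move=> D0 E0 v; rewrite ffunE addr_ge0. Qed.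

Lemma effective_point q : effective (point q).
Proof. by move=> v; rewrite ffunE. Qed.

Lemma effective_subr_point D q :
  effective D -> 1 <= D q -> effective (D - point q).
Proof.
move=> D0 Dq v; rewrite !ffunE; case: eqVneq => [-> /=|_ /=].
  by rewrite subr_ge0.
by rewrite subr0.
Qed.

Lemma effective_deg1 E : effective E -> deg E = 1 -> exists q, E = point q.
Proof.
move=> E0 E1.
have [q Eq] : exists q, 1 <= E q.
  apply: NNPP => nE; move: E1; rewrite /deg big1 // => v _.
  have := E0 v; have [Ev|Ev] := lerP 1 (E v); first by case: nE; exists v.
  by lia.
exists q; have F0 := effective_subr_point E q E0 Eq.
have : deg (E - point q) = 0 by rewrite degD degN deg_point E1.
move=> /eqP; rewrite psumr_eq0 // => /allP F.
apply/eqP; rewrite -subr_eq0; apply/eqP/ffunP => v.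
by rewrite [RHS]ffunE; apply/eqP; apply: F; rewrite mem_index_enum.
Qed.

Lemma effective_removable D q :
  effective D -> 1 <= D q -> equiv_effective (D - point q).
Proof.
move=> D0 Dq; exists (D - point q); first exact: effective_subr_point.
exact: equivalent_refl.
Qed.

Lemma positive_rank_removable D :
  positive_rank D -> forall q, equiv_effective (D - point q).
Proof.
move=> [r [[_ ->] //|[_ [k [-> Dk _]]]] k0] q.
have Eff : effective (point q *+ k).
  by move=> v; rewrite ffunMnE mulrn_wge0 // ffunE.
have deg_by_parts l : deg (point q *+ l) = l%:Z.
  elim: l => [|l IH]; last by rewrite mulrS degD deg_point IH; lia.
  by rewrite /deg big1 // => v _; rewrite mulr0n ffunE.
have [F F0 DF] := Dk _ Eff (deg_by_parts k).
(* Rank [k] allows the removal of [k] chips at [q]; all but one of them are given back. *)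
exists (F + point q *+ k.-1).
  apply: effectiveD => // v; rewrite ffunMnE mulrn_wge0 // ffunE //.
have := equivalentDr _ _ (point q *+ k.-1) DF; congr equivalent.
case: k k0 {Dk Eff DF} => // k _ /=.
by rewrite mulrS opprD addrA subrK.
Qed.

(** Equivalence preserves degree, so removing [l] chips at [q0] is possible only for [l] at most the
    degree; hence a maximal rank exists, and it is at least 1. *)
Lemma removable_positive_rank D (q0 : G) :
  (forall q, equiv_effective (D - point q)) -> positive_rank D.
Proof.
move=> rD.
have D1 : all_removable D 1.
  by move=> E E0 /(effective_deg1 _ E0)[q ->].
have bd l : all_removable D l -> (l <= `|deg D|%N)%N.
  move=> Dl; pose E : divisor G := [ffun v => if v == q0 then l%:Z else 0].
  have E0 : effective E by move=> v; rewrite ffunE; case: ifP.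
  have dE : deg E = l%:Z.
    rewrite /deg (bigD1 q0) //= ffunE eqxx big1 ?addr0 // => v /negbTE vq.
    by rewrite ffunE vq.
  have [F /deg_ge0 F0 /deg_equivalent] := Dl E E0 dE.
  by rewrite degD degN dE; lia.
have [k [Dk k1 kmax]] := bounded_max _ _ _ D1 bd.
exists k%:Z; last by lia.
right; split; last by exists k.
have [F F0 DF] := rD q0; exists (F + point q0).
  by apply: effectiveD => //; apply: effective_point.
by rewrite -[D](subrK (point q0)); apply: equivalentDr.
Qed.

Lemma positive_rank_equivalent D E (q0 : G) :
  equivalent D E -> positive_rank D -> positive_rank E.
Proof.
move=> DE /positive_rank_removable rD.
apply: (removable_positive_rank _ q0) => q.
have [F F0 DF] := rD q; exists F => //; apply: equivalent_trans DF.
by apply: equivalentDr; apply: equivalent_sym.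
Qed.

Lemma positive_rank_effective D :
  positive_rank D -> exists2 E, effective E & equivalent D E.
Proof. by move=> [r [[_ ->] //|[DE _]]]. Qed.

(** * Legal firing sets *)

Definition outdeg A (v : G) : nat := (\sum_(u | u \notin A) mult v u)%N.

(** When all of [A] fires at once, a vertex of [A] loses one chip per edge leaving [A]; none may go
    into debt. *)
Definition fireable D A : Prop := forall v, v \in A -> (outdeg A v)%:Z <= D v.

(* The set on which a firing script is maximal can be fired legally first. *)
Lemma positive_rank_fireable D q :
  effective D -> positive_rank D -> D q = 0 ->
  exists A, [/\ A != set0, q \notin A & fireable D A].
Proof.
move=> D0 /positive_rank_removable/(_ q)[E E0 /equivalentP[f Hf]] Dq.
have Df v : D v = E v + (v == q)%:Z + \sum_u (mult v u)%:Z * (f v - f u).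
  by have /ffunP/(_ v) := Hf; rewrite !ffunE => <-; ring.
pose w := [arg max_(v > q) f v]%O.
have wmax v : f v <= f w by rewrite /w; case: arg_maxP => //= u _; apply.
exists [set v | f v == f w]; split.
- by apply/set0Pn; exists w; rewrite inE.
(* If [f] were maximal at [q], then [Df] would give [D q >= 1]. *)
- rewrite inE; apply/negP => /eqP fq; have := Df q; rewrite Dq eqxx /=.
  have : 0 <= \sum_u (mult q u)%:Z * (f q - f u).
    by apply: sumr_ge0 => u _; rewrite mulr_ge0 // subr_ge0 fq.
  by move: (\sum_u _) (E0 q) => s; lia.
move=> v; rewrite inE => /eqP fv; rewrite Df.
apply: (@le_trans _ _ (\sum_u (mult v u)%:Z * (f v - f u))); last first.
  by rewrite lerDr addr_ge0.
rewrite /outdeg Posz_sum [leRHS](bigID (mem [set v | f v == f w])) /=.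
rewrite [X in _ <= X + _]big1 ?add0r; last first.
  by move=> u; rewrite inE fv => /eqP ->; rewrite subrr mulr0.
(* Since [f] is integral, it drops by at least 1 across each edge leaving the set. *)
apply: ler_sum => u; rewrite inE => fu; rewrite ler_peMr // fv.
by have := wmax u; lia.
Qed.

(** Firing [A] stays effective and sends a chip to [q] along its edge to [A]; that chip can then be
    removed. *)
Lemma fireable_removable D A q :
  effective D -> fireable D A -> q \notin A ->
  (exists2 u, u \in A & adj q u) -> equiv_effective (D - point q).
Proof.
move=> D0 DA qA [w wA qw].
pose f : {ffun G -> int} := [ffun v => (v \in A)%:Z].
exists (D - firing f - point q); last first.
  by apply/equivalentP; exists f; rewrite opprB addrA subrK opprB addrC subrK.
have inA v : v \in A -> firing f v = (outdeg A v)%:Z.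
  move=> vA; rewrite ffunE /outdeg Posz_sum [RHS]big_mkcond /=.
  by apply: eq_bigr => u _; rewrite !ffunE vA; case: (u \in A) => /=; ring.
have outA v : v \notin A -> firing f v = - (\sum_(u in A) mult v u)%N%:Z.
  move=> vA; rewrite ffunE Posz_sum [in RHS]big_mkcond -sumrN /=.
  apply: eq_bigr => u _; rewrite !ffunE (negbTE vA).
  by case: (u \in A) => /=; ring.
have E0 : effective (D - firing f).
  move=> v; rewrite ffunE [X in _ + X]ffunE.
  have [vA|vA] := boolP (v \in A); first by rewrite inA // subr_ge0 DA.
  by rewrite outA // opprK addr_ge0.
apply: effective_subr_point => //.
rewrite ffunE [X in _ <= _ + X]ffunE outA // opprK (bigD1 w) //=.
by have := D0 q; move: qw; rewrite /adj; lia.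
Qed.

End ChipFiring.

Arguments point {G} q.
Arguments firing {G} f.
Arguments outdeg {G} A v.
Arguments fireable {G} D A.

(** * The clique of hubs with branches attached *)

Section BranchedClique.
Variables n k : nat.

(** The summands are the hubs, the mids and the leaves; [ord0] is the distinguished hub. *)
Definition bc_vertex : finType := ('I_n.+2 + ('I_k + 'I_k))%type.

Definition bc_edge (u v : bc_vertex) : bool :=
  match u, v with
  | inl a, inl b => a != b
  | inl _, inr (inl _) | inr (inl _), inl _ => true
  | inl a, inr (inr _) | inr (inr _), inl a => a == ord0
  | inr (inl s), inr (inr t) | inr (inr t), inr (inl s) => s == t
  | _, _ => false
  end.

Lemma bc_edge_sym u v : bc_edge u v = bc_edge v u :> nat.
Proof. by case: u v => [a|[s|s]] [b|[t|t]] //=; rewrite eq_sym. Qed.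

Lemma bc_edge_irrefl v : bc_edge v v = 0%N :> nat.
Proof. by case: v => [a|[s|s]] //=; rewrite eqxx. Qed.

Definition branched_clique : multigraph :=
  @Multigraph bc_vertex bc_edge bc_edge_sym bc_edge_irrefl.

Local Notation G := branched_clique.

Definition hub (a : 'I_n.+2) : G := inl a.
Definition mid (s : 'I_k) : G := inr (inl s).
Definition leaf (s : 'I_k) : G := inr (inr s).

Lemma branched_clique_connected : connected G.
Proof.
split; first by apply/card_gt0P; exists (hub ord0).
have to0 v : connect (@adj G) v (hub ord0).
  case: v => [a|[s|s]]; try exact: connect1.
  have [->|a0] := eqVneq a ord0; first exact: connect0.
  by apply: connect1; rewrite /adj /= a0.
have cs : connect_sym (@adj G).
  by apply: sym_connect_sym => u v; rewrite /adj mult_sym.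
by move=> u v; apply: connect_trans (to0 u) _; rewrite cs.
Qed.

Lemma branched_clique_simple : simple_graph G.
Proof. by move=> u v /=; case: bc_edge. Qed.

(** * Sizes of cuts *)

Implicit Types (D : divisor G) (A : {set G}).

Lemma deg_by_parts D :
  deg D = \sum_a D (hub a) + (\sum_s D (mid s) + \sum_s D (leaf s)).
Proof. by rewrite /deg big_sumType big_sumType. Qed.

(** Sums of ones rather than cardinals, to match the sums in [outdegE] and [sum_ge_count]. *)
Definition hubs_out A : nat := (\sum_(a | hub a \notin A) 1)%N.
Definition mids_out A : nat := (\sum_(s | mid s \notin A) 1)%N.
Definition leaves_out A : nat := (\sum_(s | leaf s \notin A) 1)%N.

Lemma outdegE A v : outdeg A v =
  (\sum_(a | hub a \notin A) mult v (hub a) +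
   (\sum_(s | mid s \notin A) mult v (mid s) +
    \sum_(s | leaf s \notin A) mult v (leaf s)))%N.
Proof. by rewrite /outdeg big_sumType big_sumType. Qed.

Lemma outdeg_hub A a : hub a \in A ->
  outdeg A (hub a) =
  (hubs_out A + (mids_out A + (a == ord0) * leaves_out A))%N.
Proof.
move=> aA; rewrite outdegE; congr (_ + (_ + _))%N.
  apply: eq_bigr => b bA /=; case: eqVneq => // ab.
  by rewrite -ab aA in bA.
by rewrite /leaves_out big_distrr /=; apply: eq_bigr => s _; rewrite muln1.
Qed.

Lemma outdeg_mid A s :
  outdeg A (mid s) = (hubs_out A + (leaf s \notin A))%N.
Proof.
rewrite outdegE; congr (_ + _)%N.
rewrite big1 // add0n big_mkcond (bigD1 s) //= eqxx big1 ?addn0.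
  by case: (leaf s \notin A).
by move=> t ts; rewrite eq_sym (negbTE ts); case: ifP.
Qed.

Lemma outdeg_leaf A s :
  outdeg A (leaf s) = ((hub ord0 \notin A) + (mid s \notin A))%N.
Proof.
rewrite outdegE [X in (_ + (_ + X))%N]big1 // addn0; congr (_ + _)%N.
  rewrite big_mkcond (bigD1 ord0) //= big1 ?addn0.
    by case: (hub ord0 \notin A).
  by move=> a /negbTE a0; rewrite a0; case: ifP.
rewrite big_mkcond (bigD1 s) //= eqxx big1 ?addn0.
  by case: (mid s \notin A).
by move=> t /negbTE ts; rewrite ts; case: ifP.
Qed.

Lemma hubs_out_gt0 A a : hub a \notin A -> (0 < hubs_out A)%N.
Proof. by move=> aA; rewrite /hubs_out (bigD1 a). Qed.

Lemma mids_out_gt0 A s : mid s \notin A -> (0 < mids_out A)%N.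
Proof. by move=> sA; rewrite /mids_out (bigD1 s). Qed.

Lemma leaves_out_gt0 A s : leaf s \notin A -> (0 < leaves_out A)%N.
Proof. by move=> sA; rewrite /leaves_out (bigD1 s). Qed.

Lemma hubs_in A :
  (\sum_(a | hub a \in A) 1 = n.+2 - hubs_out A)%N.
Proof.
have : (\sum_(a : 'I_n.+2) 1 = n.+2)%N by rewrite sum1_card card_ord.
by rewrite (bigID (fun a => hub a \in A)) /= -/(hubs_out A); lia.
Qed.

Lemma mids_in A : (\sum_(s | mid s \in A) 1 = k - mids_out A)%N.
Proof.
have : (\sum_(s : 'I_k) 1 = k)%N by rewrite sum1_card card_ord.
by rewrite (bigID (fun s => mid s \in A)) /= -/(mids_out A); lia.
Qed.

Lemma hubs_out_le A : (hubs_out A <= n.+2)%N.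
Proof.
rewrite -[leqRHS]card_ord -sum1_card /hubs_out.
by rewrite [leqRHS](bigID (fun a => hub a \notin A)) leq_addr.
Qed.

Lemma mids_out_le A : (mids_out A <= k)%N.
Proof.
rewrite -[leqRHS]card_ord -sum1_card /mids_out.
by rewrite [leqRHS](bigID (fun s => mid s \notin A)) leq_addr.
Qed.

(** * Lower bound for the gonality *)

Lemma leaf_fireable D A :
  A != set0 -> fireable D A ->
  (forall a, hub a \notin A) -> (forall s, mid s \notin A) ->
  exists s, 2 <= D (leaf s).
Proof.
move=> /set0Pn[[a|[s|s]] vA] DA hA mA.
- by have := hA a; rewrite /hub vA.
- by have := mA s; rewrite /mid vA.
exists s; have := DA _ vA.
by rewrite -/(leaf s) outdeg_leaf hA mA.
Qed.

(* Cuts with at most [n + 2] edges separate only leaves from the rest. *)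
Lemma small_fireable D A q :
  effective D -> (1 < k)%N -> deg D <= n.+2%:Z ->
  A != set0 -> fireable D A -> q \notin A -> (forall s, q != leaf s) ->
  exists s, 2 <= D (leaf s).
Proof.
move=> D0 k1; rewrite deg_by_parts => dD A0 DA qA ql.
have h0 a : 0 <= D (hub a) by [].
have m0 s : 0 <= D (mid s) by [].
have l0 s : 0 <= D (leaf s) by [].
have hge a : hub a \in A -> (hubs_out A + mids_out A)%N%:Z <= D (hub a).
  by move=> aA; apply: le_trans (DA _ aA); rewrite outdeg_hub //; lia.
have mge s : mid s \in A -> (hubs_out A)%:Z <= D (mid s).
  by move=> sA; apply: le_trans (DA _ sA); rewrite outdeg_mid; lia.
have hsum := sum_ge_count _ (fun a => hub a \in A) _ _ h0 hge.
have msum := sum_ge_count _ (fun s => mid s \in A) _ _ m0 mge.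
have lsum : 0 <= \sum_s D (leaf s) by apply: sumr_ge0.
rewrite hubs_in in hsum; rewrite mids_in in msum.
have hle := hubs_out_le A; have mle := mids_out_le A.
have mid_le s := sum_ge_term _ _ s m0.
have leaf_le s := sum_ge_term _ _ s l0.
have leaf_in s : leaf s \in A -> (hub ord0 \notin A) || (mid s \notin A) ->
    1 <= \sum_s D (leaf s).
  move=> sA nA; apply: le_trans (leaf_le s); apply: le_trans (DA _ sA).
  by rewrite outdeg_leaf; move: nA; do 2!case: (_ \notin A).
(* With no hub in [A], a mid in [A] pays [n + 2] chips to the hubs. One more is paid by its leaf to
   the distinguished hub, if the leaf is in [A], and otherwise by the mid to the leaf. That exceeds
   the degree, so [A] contains only leaves. *)
have [P0|P0] := posnP (n.+2 - hubs_out A)%N.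
  have hA a : hub a \notin A.
    apply/negP => aA.
    have : (0 < \sum_(a | hub a \in A) 1)%N by rewrite (bigD1 a).
    by rewrite hubs_in P0.
  apply: (leaf_fireable D A) => // s; apply/negP => sA.
  have := DA _ sA; rewrite outdeg_mid => Ds.
  have := mid_le s.
  have h := sumr_ge0 _ (fun a _ => h0 a) : 0 <= \sum_a D (hub a).
  have [lA|lA] := boolP (leaf s \in A).
    by have := leaf_in s lA; rewrite hA => /(_ isT); lia.
  by move: Ds; rewrite lA; lia.
have [R0|R0] := posnP (hubs_out A); last first.
  (* With [P > 0] hubs inside, [R > 0] outside and [M] mids outside, at least [P(R + M) + (k - M)R]
     chips are needed. Here [PR >= P + R - 1] and [PM + (k - M)R >= k >= 2], for a total of at least
     [n + 3]. *)
  by exfalso; move: hsum msum dD lsum; nia.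
(* Now all hubs lie in [A] and [q] is a mid outside it, so every hub pays a chip to [q]. One more is
   paid by the leaf next to [q], or by the distinguished hub to that leaf. *)
have hA a : hub a \in A by apply/negPn/negP => /hubs_out_gt0; rewrite R0.
case: q qA ql => [a|[s|s]] qA ql; last by have := ql s; rewrite eqxx.
  by have := hA a; rewrite /hub (negbTE qA).
have mgt := mids_out_gt0 A s qA.
exfalso; have [lA|lA] := boolP (leaf s \in A).
  have := leaf_in s lA; rewrite qA orbT => /(_ isT).
  by have := sumr_ge0 _ (fun s _ => m0 s) : 0 <= \sum_s D (mid s); nia.
have lgt := leaves_out_gt0 A s lA.
have := DA _ (hA ord0); rewrite outdeg_hub // eqxx mul1n => D00.
have : n.+3%:Z <= \sum_a D (hub a).
  rewrite big_ord_recl.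
  have : ((\sum_(x : 'I_n.+1 | true) 1) * 1)%N%:Z
      <= \sum_x D (hub (lift ord0 x)).
    apply: sum_ge_count => // x _; apply: le_trans (hge _ (hA _)); lia.
  rewrite sum1_card card_ord; move: (\sum_x _) D00 => x.
  by move: (D _) => y; lia.
have := sumr_ge0 _ (fun s _ => m0 s) : 0 <= \sum_s D (mid s).
by lia.
Qed.

Lemma branched_clique_gon_ge D :
  (1 < k)%N -> positive_rank D -> n.+3%:Z <= deg D.
Proof.
move=> k1 rD; rewrite leNgt; apply/negP => dD.
have [E E0 DE] := positive_rank_effective _ _ rD.
(* A leaf has two edges, and its neighbours do not fire, so [E v %/ 2] firings leave it with 0 or 1
   chips. All other vertices can only gain. *)
pose g : {ffun G -> int} :=
  [ffun v => if v is inr (inr s) then (E v %/ 2)%Z else 0].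
have g0 v : 0 <= g v.
  by rewrite ffunE; case: v => [a|[s|s]] //; rewrite divz_ge0.
pose F : divisor G := E - firing g.
have FE v : F v = E v - firing g v by rewrite ffunE [X in _ + X]ffunE.
have Fleaf s : F (leaf s) = (E (leaf s) %% 2)%Z.
  rewrite FE; have -> : firing g (leaf s) = 2 * (E (leaf s) %/ 2)%Z.
    rewrite ffunE big_sumType big_sumType /=.
    rewrite (bigD1 ord0) //= big1 ?addr0; last first.
      by move=> a /negbTE a0; rewrite a0 mul0r.
    rewrite (bigD1 s) //= eqxx big1 ?addr0; last first.
      by move=> t /negbTE ts; rewrite ts mul0r.
    rewrite big1 => [|t _]; last by rewrite mul0r.
    have -> : g (inr (inr s)) = (E (leaf s) %/ 2)%Z by rewrite ffunE.
    by rewrite !ffunE /= !mul1r !subr0 mulr_natl.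
  by rewrite {1}(divz_eq (E (leaf s)) 2); lia.
have F0 : effective F.
  move=> v; have gle0 : (forall s, v != leaf s) -> 0 <= F v.
    move=> vl; rewrite FE subr_ge0; apply: le_trans (E0 v).
    rewrite ffunE; apply: sumr_le0 => u _; rewrite mulr_ge0_le0 //.
    have -> : g v = 0 by rewrite ffunE; case: v vl => [a|[s|s]] // /(_ s)/eqP.
    by rewrite sub0r oppr_le0.
  case: v gle0 => [a|[s|s]] gle0; try exact: gle0.
  by rewrite -/(leaf s) Fleaf modz_ge0.
have EF : equivalent E F.
  by apply/equivalentP; exists g; rewrite /F opprB addrC subrK.
have DF := equivalent_trans _ _ _ _ DE EF.
have rF := positive_rank_equivalent _ _ _ (hub ord0) DF rD.
have dF : deg F <= n.+2%:Z.
  by rewrite -(deg_equivalent _ _ _ DF) -ltzD1 -PoszD addn1.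
(* An empty non-leaf [q] would give a legal set avoiding it, hence a leaf with two chips. So all
   [n + 2] hubs and [k] mids carry chips, too many for the degree. *)
have Fge q : (forall s, q != leaf s) -> 1 <= F q.
  move=> ql; have := F0 q; rewrite le_eqVlt => /orP[/eqP Fq|]; last by lia.
  have [A [A0 qA FA]] := positive_rank_fireable _ _ q F0 rF (esym Fq).
  have [s] := small_fireable F A q F0 k1 dF A0 FA qA ql.
  by rewrite Fleaf; have := ltz_pmod (E (leaf s)) (isT : 0 < 2 :> int); lia.
have hsum : ((\sum_(a : 'I_n.+2 | true) 1) * 1)%N%:Z <= \sum_a F (hub a).
  by apply: sum_ge_count => // a _; apply: Fge.
have msum : ((\sum_(s : 'I_k | true) 1) * 1)%N%:Z <= \sum_s F (mid s).
  by apply: sum_ge_count => // s _; apply: Fge.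
have lsum : 0 <= \sum_s F (leaf s) by apply: sumr_ge0.
rewrite sum1_card card_ord in hsum; rewrite sum1_card card_ord in msum.
by move: dF; rewrite deg_by_parts; lia.
Qed.

(** * Lower bound for the multiplicity-free gonality *)

Lemma mf_fireable_hub D A :
  multiplicity_free D -> A != set0 -> fireable D A ->
  exists a, hub a \in A.
Proof.
move=> [D0 D1] A0 DA; apply: NNPP => nA.
have hA a : hub a \notin A by apply/negP => aA; apply: nA; exists a.
(* With no hub in [A], a mid in [A] would pay [n + 2 >= 2] chips. *)
have mA s : mid s \notin A.
  apply/negP => sA; have := DA _ sA; have := D1 (mid s).
  have := hubs_in A; rewrite big_pred0 => [|a]; last exact: negbTE.
  by rewrite outdeg_mid; lia.
have [s] := leaf_fireable D A A0 DA hA mA.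
by have := D1 (leaf s); lia.
Qed.

(** If the branch is empty, a legal set avoiding its mid also avoids its leaf. The distinguished hub
    would pay both, so it stays out; any other hub would then pay the mid and the distinguished hub.
    No hub is left for [A]. *)
Lemma mf_branch_ge1 D s :
  multiplicity_free D -> positive_rank D -> 1 <= D (mid s) + D (leaf s).
Proof.
move=> mfD rD; have [D0 D1] := mfD.
rewrite leNgt; apply/negP => Ds.
have Dm : D (mid s) = 0 by have := D0 (mid s); have := D0 (leaf s); lia.
have Dl : D (leaf s) = 0 by have := D0 (mid s); have := D0 (leaf s); lia.
have [A [A0 sA DA]] := positive_rank_fireable _ _ (mid s) D0 rD Dm.
have lA : leaf s \notin A.
  by apply/negP => lA; have := DA _ lA; rewrite outdeg_leaf sA Dl; lia.
have mgt := mids_out_gt0 _ _ sA; have lgt := leaves_out_gt0 _ _ lA.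
have h0 : hub ord0 \notin A.
  apply/negP => hA; have := DA _ hA; have := D1 (hub ord0).
  by rewrite outdeg_hub // eqxx mul1n; lia.
have hgt := hubs_out_gt0 _ _ h0.
have [a aA] := mf_fireable_hub _ _ mfD A0 DA.
by have := DA _ aA; have := D1 (hub a); rewrite outdeg_hub //; lia.
Qed.

(** The branches hold at least [k] chips. If some hub is empty, a legal set avoiding it contains a
    hub, whose single chip forces exactly one hub outside; the [n + 1] hubs inside each pay a chip
    to it. *)
Lemma branched_clique_mfgon_ge D :
  multiplicity_free D -> positive_rank D -> (n.+1 + k)%N%:Z <= deg D.
Proof.
move=> mfD rD; have [D0 D1] := mfD.
rewrite leNgt deg_by_parts -big_split /=; apply/negP.
set h := \sum_a D (hub a); set b := \sum_s (_ + _) => dD.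
have bsum : ((\sum_(s : 'I_k | true) 1) * 1)%N%:Z
    <= b.
  apply: sum_ge_count => s; first by rewrite addr_ge0.
  by move=> _; apply: mf_branch_ge1.
rewrite sum1_card card_ord in bsum.
have [a Da] : exists a, D (hub a) = 0.
  apply: NNPP => nD.
  have : ((\sum_(a : 'I_n.+2 | true) 1) * 1)%N%:Z <= \sum_a D (hub a).
    apply: sum_ge_count => // a _; have := D0 (hub a).
    by rewrite le_eqVlt => /orP[/eqP Da|]; [case: nD; exists a | lia].
  by rewrite sum1_card card_ord -/h; lia.
have [A [A0 aA DA]] := positive_rank_fireable _ _ (hub a) D0 rD Da.
have Rgt := hubs_out_gt0 _ _ aA.
have [c cA] := mf_fireable_hub _ _ mfD A0 DA.
have R1 : hubs_out A = 1%N.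
  by have := DA _ cA; have := D1 (hub c); rewrite outdeg_hub //; lia.
have : ((\sum_(a | hub a \in A) 1) * 1)%N%:Z <= \sum_a D (hub a).
  apply: sum_ge_count => // e eA; apply: le_trans (DA _ eA).
  by rewrite outdeg_hub // R1; lia.
by rewrite hubs_in R1 -/h; lia.
Qed.

(** * Divisors attaining the two bounds *)

Definition gon_divisor : divisor G :=
  [ffun v => if v is inl a then 1 + (a == ord0)%:Z else 0].

Lemma effective_gon_divisor : effective gon_divisor.
Proof. by move=> [a|[s|s]]; rewrite ffunE. Qed.

Lemma deg_gon_divisor : deg gon_divisor = n.+3%:Z.
Proof.
rewrite deg_by_parts [X in _ + (X + _)]big1; last by move=> s _; rewrite ffunE.
rewrite [X in _ + (_ + X)]big1; last by move=> s _; rewrite ffunE.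
rewrite big_ord_recl; under eq_bigr => a _ do rewrite ffunE /= addr0.
by rewrite ffunE /= sumr_const card_ord; lia.
Qed.

Lemma positive_rank_gon_divisor : positive_rank gon_divisor.
Proof.
have E0 := effective_gon_divisor.
apply: (removable_positive_rank _ _ (hub ord0)) => q.
have branch s : q \in [set mid s; leaf s] ->
    equiv_effective (gon_divisor - point q).
  (* The cut around a branch has one edge at each hub and a second one at the distinguished hub,
     matching [gon_divisor] exactly. *)
  move=> qs; apply: (fireable_removable _ _ (~: [set mid s; leaf s])) => //.
  - move=> v vA; rewrite /outdeg (eq_bigl (mem [set mid s; leaf s])); last first.
      by move=> u; rewrite !inE negbK.
    rewrite big_setU1 ?inE //= big_set1.
    case: v vA => [a|[t|t]]; rewrite ffunE !inE //=.
      rewrite negb_or => /andP[+ _].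
      by case: (eqVneq t s) => [->|//]; rewrite eqxx.
    by case: (eqVneq s t) => [->|]; rewrite ?eqxx.
  - by rewrite inE negbK.
  by exists (hub ord0); [rewrite !inE | move: qs; rewrite !inE => /orP[]/eqP->].
case: q branch => [a|[s|s]] branch.
- by apply: effective_removable; rewrite // ffunE; lia.
- by apply: (branch s); rewrite !inE eqxx.
- by apply: (branch s); rewrite !inE eqxx orbT.
Qed.

(** There are at least two hubs, so the empty hub [ord_max] is not the distinguished one and has no
    leaf as neighbour. *)
Definition mf_divisor : divisor G :=
  [ffun v => match v with
             | inl a => (a != ord_max)%:Z
             | inr (inl _) => 1
             | inr (inr _) => 0
             end].

Lemma mf_divisor_multiplicity_free : multiplicity_free mf_divisor.
Proof.
by split=> -[a|[s|s]]; rewrite ffunE //; case: (a != ord_max).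
Qed.

Lemma deg_mf_divisor : deg mf_divisor = (n.+1 + k)%N%:Z.
Proof.
rewrite deg_by_parts [X in _ + (_ + X)]big1; last by move=> s _; rewrite ffunE.
under [X in _ + (X + _)]eq_bigr => s _ do rewrite ffunE /=.
rewrite sumr_const card_ord big_ord_recr /=.
have -> : mf_divisor (hub ord_max) = 0 by rewrite ffunE /= eqxx.
rewrite (eq_bigr (fun=> 1)) => [|a _]; last first.
  by rewrite ffunE /= -val_eqE /= neq_ltn ltn_ord.
by rewrite sumr_const card_ord; lia.
Qed.

Lemma positive_rank_mf_divisor : positive_rank mf_divisor.
Proof.
have [E0 E1] := mf_divisor_multiplicity_free.
apply: (removable_positive_rank _ _ (hub ord0)) => q.
have [Eq|Eq] := lerP 1 (mf_divisor q); first exact: effective_removable.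
(* The complement of the support is independent, so everything but [q] fires. *)
have qE : q = hub ord_max \/ exists s, q = leaf s.
  case: q Eq => [a|[s|s]]; rewrite ffunE //; last by right; exists s.
  by case: eqVneq => // ->; left.
have fireq v : (mult v q)%:Z <= mf_divisor v.
  case: qE => [->|[s ->]]; case: v => [a|[t|t]]; rewrite ffunE //=.
    by case: eqVneq => // ->.
  by case: (t == s).
apply: (fireable_removable _ _ (~: [set q])) => //.
- move=> v _; rewrite /outdeg (eq_bigl (mem [set q])); last first.
    by move=> u; rewrite !inE negbK.
  by rewrite big_set1.
- by rewrite !inE eqxx.
by exists (hub ord0); case: qE => [->|[s ->]]; rewrite ?inE.
Qed.

End BranchedClique.

(** * Realizing a prescribed pair of gonalities *)

Theorem theorem4p2 (i j : int) (hi : 3 <= i) (hij : i <= j) :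
  exists G : multigraph,
    [/\ connected G, simple_graph G, has_gon G i & has_mfgon G j].
Proof.
(* Both arguments of [absz] are nonnegative. The [i - 1] hubs become [n + 2], and [i <= j] yields
   the two branches that the gonality bound requires. *)
pose n := absz (i - 3); pose k := absz (j - i + 2).
have k1 : (1 < k)%N by lia.
have -> : i = n.+3%:Z by lia.
have -> : j = (n.+1 + k)%N%:Z by lia.
exists (branched_clique n k); split.
- exact: branched_clique_connected.
- exact: branched_clique_simple.
- split; last first.
    by move=> m [D rD <-]; apply: branched_clique_gon_ge.
  exists (gon_divisor n k); first exact: positive_rank_gon_divisor.
  exact: deg_gon_divisor.
split.
  exists (mf_divisor n k); last exact: deg_mf_divisor.
  split; first exact: mf_divisor_multiplicity_free.
  exact: positive_rank_mf_divisor.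
by move=> m [D [mfD rD] <-]; apply: branched_clique_mfgon_ge.
Qed.
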